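(* Let $k$ be a field and let $L=\bigoplus_{i\ge1}\gamma_i(L)/\gamma_{i+1}(L)$ be the free two generated infinite dimensional graded Lie algebra over $k$, where $\gamma_i(L)$ is the lower central series. Then for each $i$ there exist closed subalgebras of $L$ of codimension $2$ not containing $\gamma_i(L)$.
   Context: $\gamma_1(L)=L$ and $\gamma_{i}(L)=(\gamma_{i-1}(L),L)$ (span of brackets). $L$ is filtered by the subspaces $\gamma_i(L)$, which form a neighbourhood base of zero for a (formal) topology; a subalgebra $H$ of $L$ is closed if $H=\bigcap_i(H+\gamma_i(L))$. Codimension is over $k$. *)

(* Defs.v *)
From HB Require Import structures.
From mathcomp Require Import all_boot all_order all_algebra.
From mathcomp Require Import boolp classical_sets.

Set Implicit Arguments.
Unset Strict Implicit.
Unset Printing Implicit Defensive.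

Import GRing.Theory.
Local Open Scope classical_set_scope.
Local Open Scope ring_scope.

(* The bracket is required to be alternating, not merely antisymmetric, so that
   the axioms are the right ones in characteristic 2 as well. *)
HB.mixin Record Lmodule_isLieAlgebra (k : fieldType) L & GRing.Lmodule k L := {
  bracket : L -> L -> L;
  bracket_linearl : forall b : L, linear (bracket^~ b);
  bracket_linearr : forall a : L, linear (bracket a);
  bracket_alt : forall a : L, bracket a a = 0;
  bracket_jacobi : forall a b c : L,
    bracket a (bracket b c) + bracket b (bracket c a)
      + bracket c (bracket a b) = 0
}.

#[short(type="lieAlgType")]
HB.structure Definition LieAlgebra (k : fieldType) :=
  { L of Lmodule_isLieAlgebra k L & GRing.Lmodule k L }.

Definition lie_hom (k : fieldType) (L M : lieAlgType k) (f : L -> M) : Prop :=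
  linear f /\ {morph f : a b / bracket a b}.

Definition lie_free_on (k : fieldType) (L : lieAlgType k)
    (I : Type) (e : I -> L) : Prop :=
  forall (M : lieAlgType k) (m : I -> M),
    exists! f : L -> M, lie_hom f /\ forall i, f (e i) = m i.

Section Subspaces.
Variables (k : fieldType) (L : lieAlgType k).

Definition subspace (S : set L) : Prop := submod_closed [in S].

Definition lin_span (A : set L) : set L := smallest subspace A.

Definition subalgebra (H : set L) : Prop :=
  subspace H /\ forall a b, H a -> H b -> H (bracket a b).

(* The index starts at 1, as in the usual convention gamma_1(L) = L; the value
   at 0 is a dummy. *)
Fixpoint lcs (i : nat) : set L :=
  match i with
  | 0 => setT
  | j.+1 =>
    match j with
    | 0 => setT
    | _ => lin_span [set bracket a b | a in lcs j & b in setT]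
    end
  end.

Definition lcs_closed (H : set L) : Prop :=
  H = \bigcap_(i in [set i : nat | (0 < i)%N])
        [set h + g | h in H & g in lcs i].

(* The classes of the [e j] form a basis of the quotient space L / H. *)
Definition codim (H : set L) (n : nat) : Prop :=
  exists e : 'I_n -> L, forall v : L,
    exists! c : 'rV[k]_n, H (v - \sum_(j < n) c 0 j *: e j).

End Subspaces.

Arguments lcs {k} L i.

(* Main.v *)
Require Import Defs.
From HB Require Import structures.
From mathcomp Require Import all_boot all_order all_algebra.
From mathcomp Require Import boolp classical_sets.
From mathcomp Require Import ring.

(** The idea is to map [L] to a metabelian Lie algebra [k x + A], where [A] is
    an abelian ideal of codimension 1 on which [x] acts by a shift.  Any
    hyperplane of [A] is a subalgebra, because [A] is abelian, and it has
    codimension 2.  With [A = k[t]] and [x] acting as multiplication by [t], the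
    [j]-th term of the lower central series ([j >= 2]) lies in [t^(j-1) k[t]].
    The hyperplane [p_(i-1) = 0] of [A] therefore contains the image of
    [gamma_(i+1)], which makes its preimage closed ([lcs_sub_order_ge] and
    [lcs_closed_of_sub]).  It misses [t^(i-1)], which is the image of the left
    normed commutator [y, x, ..., x] of weight [i] in the two generators
    ([left_comm_lcs] and [left_comm_image]). *)

Set Implicit Arguments.
Unset Strict Implicit.
Unset Printing Implicit Defensive.

Import GRing.Theory.
Local Open Scope classical_set_scope.
Local Open Scope ring_scope.

Section SubspaceFacts.
Variables (k : fieldType) (L : lieAlgType k).

Lemma subspaceP (S : set L) :
  S 0 -> (forall (c : k) u v, S u -> S v -> S (c *: u + v)) -> subspace S.
Proof.
move=> S0 SP; split => [|c u v]; rewrite !inE //; exact: SP.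
Qed.

Lemma subspace0 (S : set L) : subspace S -> S 0.
Proof. by case; rewrite !inE. Qed.

Lemma lin_span0 (A : set L) : lin_span A 0.
Proof. by move=> S [/subspace0]. Qed.

Lemma lcs0 j : lcs L j 0.
Proof. by case: j => [|[|j]] //; apply: lin_span0. Qed.

Lemma bracket_lcs j a b : lcs L j.+1 a -> lcs L j.+2 (bracket a b).
Proof. by move=> aj S [_]; apply; exists a => //; exists b. Qed.

(** If [gamma_(j+1)] lies in [H], then [H + gamma_(j+1)] is [H] itself, so the
    term of index [j+1] already cuts the intersection down to [H]. *)
Lemma lcs_closed_of_sub (H : set L) j :
  subspace H -> lcs L j.+1 `<=` H -> lcs_closed H.
Proof.
move=> HS sub; apply/seteqP; split=> [h Hh n _|v /(_ j.+1 isT)].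
  by exists h => //; exists 0; [apply: lcs0 | rewrite addr0].
move=> [h Hh [g /sub Hg <-]].
by case: HS => _ /(_ 1 h g); rewrite !inE scale1r; apply.
Qed.

(** The left normed commutator [y, x, ..., x], with [j] occurrences of [x]. *)
Definition left_comm (x y : L) j : L := iter j (fun w => bracket w x) y.

Lemma left_comm_lcs x y j : lcs L j.+1 (left_comm x y j).
Proof. by elim: j => // j IHj; apply: bracket_lcs. Qed.

End SubspaceFacts.

(** The semidirect product of the line [k x] and the abelian ideal [k[t]], on
    which [x] acts by multiplication by [t]; the pair [(a, p)] stands for
    [a x + p].  The sign is chosen so that bracketing with [x] on the right,
    the side on which the lower central series grows, multiplies by [t]. *)
Definition shift_ext (k : fieldType) : Type := (k^o * {poly k})%type.

Section ShiftExtension.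
Variable k : fieldType.
Implicit Types u v w : shift_ext k.

HB.instance Definition _ := GRing.Lmodule.on (shift_ext k).

Definition shift_bracket u v : shift_ext k :=
  (0, 'X * (v.1 *: u.2 - u.1 *: v.2)).

Lemma shift_bracket_linearl v : linear (shift_bracket^~ v).
Proof.
move=> c [a p] [b q]; case: v => d r; rewrite /shift_bracket.
congr (_, _) => /=; first by rewrite scaler0 addr0.
by rewrite -!mul_polyC !rmorphD !rmorphM /=; ring.
Qed.

Lemma shift_bracket_linearr u : linear (shift_bracket u).
Proof.
move=> c [a p] [b q]; case: u => d r; rewrite /shift_bracket.
congr (_, _) => /=; first by rewrite scaler0 addr0.
by rewrite -!mul_polyC !rmorphD !rmorphM /=; ring.
Qed.

Lemma shift_bracket_alt u : shift_bracket u u = 0.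
Proof. by rewrite /shift_bracket subrr mulr0. Qed.

Lemma shift_bracket_jacobi u v w :
  shift_bracket u (shift_bracket v w) + shift_bracket v (shift_bracket w u)
    + shift_bracket w (shift_bracket u v) = 0.
Proof.
case: u v w => a p [b q] [c r]; rewrite /shift_bracket.
congr (_, _) => /=; first by rewrite !addr0.
by rewrite -!mul_polyC /=; ring.
Qed.

HB.instance Definition _ := Lmodule_isLieAlgebra.Build k (shift_ext k)
  shift_bracket_linearl shift_bracket_linearr shift_bracket_alt
  shift_bracket_jacobi.

End ShiftExtension.

Section ShiftQuotient.
Variables (k : fieldType) (L : lieAlgType k) (f : L -> shift_ext k).
Hypothesis f_hom : lie_hom f.

Let f_lin c u v : f (c *: u + v) = c *: f u + f v.
Proof. by case: f_hom => + _; apply. Qed.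

Let f_bracket a b : f (bracket a b) = shift_bracket (f a) (f b).
Proof. by case: f_hom => _; apply. Qed.

Let f_0 : f 0 = 0.
Proof. by have := f_lin (-1) 0 0; rewrite scaler0 addr0 scaleN1r addNr. Qed.

Definition coef_kernel n : set L := [set v | (f v).1 = 0 /\ (f v).2`_n = 0].

Lemma subspace_coef_kernel n : subspace (coef_kernel n).
Proof.
apply: subspaceP => [|c u v]; rewrite /coef_kernel /= ?f_0 ?coef0 //.
move=> [u1 u2] [v1 v2]; rewrite f_lin /= u1 v1 coefD coefZ u2 v2.
by rewrite scaler0 mulr0 !addr0.
Qed.

(** Both factors lie over the abelian ideal, so their bracket maps to 0. *)
Lemma subalgebra_coef_kernel n : subalgebra (coef_kernel n).
Proof.
split=> [|a b [a1 _] [b1 _]]; first exact: subspace_coef_kernel.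
rewrite /coef_kernel /= f_bracket /= a1 b1 !scale0r subr0 mulr0 coef0.
by split.
Qed.

(** For [j > 0] the bracket with [(b, q)] sends [(0, p)] to [(0, t b p)], which
    raises the [t]-adic order by one.  The first component is unconstrained at
    [j = 0], and is killed by the very first bracket. *)
Lemma lcs_sub_order_ge j :
  lcs L j.+1 `<=`
  [set v | ((0 < j)%N -> (f v).1 = 0) /\ forall m, (m < j)%N -> (f v).2`_m = 0].
Proof.
elim: j => [|j IHj]; first by move=> v _; split.
apply: smallest_sub => [|_ [a /IHj [a1 a2] [b _ <-]]].
  apply: subspaceP => [|c u v] /=.
    by rewrite f_0; split=> // m _; rewrite coef0.
  move=> [u1 u2] [v1 v2]; rewrite f_lin; split=> [_|m m_lt] /=.
    by rewrite u1 // v1 // scaler0 addr0.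
  by rewrite coefD coefZ u2 // v2 // mulr0 addr0.
rewrite /= f_bracket; split=> // -[|m] m_lt; rewrite /= coefXM //=.
rewrite a1; last exact: leq_trans (ltn0Sn m) m_lt.
by rewrite scale0r subr0 coefZ a2 // mulr0.
Qed.

Lemma lcs_sub_coef_kernel n : lcs L n.+2 `<=` coef_kernel n.
Proof. by move=> v /lcs_sub_order_ge [v1 v2]; split; [apply: v1 | apply: v2]. Qed.

(** The two functionals that cut out [coef_kernel n] are dual to [x] and [w], so
    the coordinates of [v] modulo [coef_kernel n] are their values at [v]. *)
Lemma codim_coef_kernel n x w :
  f x = (1, 0) -> f w = (0, 'X^n) -> codim (coef_kernel n) 2.
Proof.
move=> fx fw; exists (fun j : 'I_2 => if j == 0 then x else w) => v.
have fE (c : 'rV[k]_2) : f (v - \sum_(j < 2) c 0 j *: (if j == 0 then x else w))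
    = ((f v).1 - c 0 0, (f v).2 - c 0 1 *: 'X^n).
  rewrite big_ord_recl big_ord1 /=.
  have -> : lift ord0 ord0 = 1 :> 'I_2 by apply/val_inj.
  have -> : v - (c 0 0 *: x + c 0 1 *: w)
      = (- c 0 0) *: x + ((- c 0 1) *: w + v).
    by rewrite !scaleNr opprD addrC -addrA.
  rewrite !f_lin fx fw; congr (_, _) => /=.
    by rewrite scaler0 add0r addrC /GRing.scale /= mulr1.
  by rewrite scaler0 add0r addrC scaleNr.
exists (\row_j if j == 0 then (f v).1 else (f v).2`_n).
split=> [|c]; rewrite /coef_kernel /= fE /= coefB coefZ coefXn eqxx mulr1.
  by rewrite !mxE /= !subrr.
move=> [/subr0_eq c0 /subr0_eq c1]; apply/rowP => j; rewrite mxE.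
case: eqP => [->|/eqP j0]; first by [].
have -> : j = 1 by apply/val_inj; case: j j0 => [[|[|]]].
by [].
Qed.

Lemma left_comm_image x y n :
  f x = (1, 0) -> f y = (0, 1) -> f (left_comm x y n) = (0, 'X^n).
Proof.
move=> fx fy; elim: n => [|n IHn] //=.
by rewrite f_bracket IHn fx /shift_bracket /= scale1r scale0r subr0 -exprS.
Qed.

End ShiftQuotient.

Theorem theorem2p34 (k : fieldType) (L : lieAlgType k) (e : 'I_2 -> L)
    (L_free : lie_free_on e) (i : nat) (i_gt0 : (0 < i)%N) :
  exists H : set L,
    [/\ subalgebra H, lcs_closed H, codim H 2 & ~ (lcs L i `<=` H)].
Proof.
case: i i_gt0 => // n _.
pose m (j : 'I_2) : shift_ext k := if j == 0 then (1, 0) else (0, 1).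
have [f [[f_hom fm] _]] := L_free (shift_ext k) m.
have fx : f (e 0) = (1, 0) by rewrite fm.
have fy : f (e 1) = (0, 1) by rewrite fm.
have fw := left_comm_image f_hom n fx fy.
exists (coef_kernel f n); split.
- exact: subalgebra_coef_kernel.
- apply: lcs_closed_of_sub (lcs_sub_coef_kernel f_hom (n := n)).
  exact: subspace_coef_kernel.
- exact: codim_coef_kernel fx fw.
- move/(_ _ (left_comm_lcs (e 0) (e 1) n)) => [_]; rewrite fw /= coefXn eqxx.
  exact/eqP/oner_neq0.
Qed.
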